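(* For all positive integers $m,n$, the coefficients $a_{\mathbf{i}}$ ($\mathbf{i}\in[n]^m$) of every extreme point $T$ of $B_{\mathcal{L}(^{m}\mathbb{R}^{n})}$ are rational numbers.
   Context: $\mathbb{R}^n$ carries the sup norm; $[n]=\{1,\dots,n\}$. $\mathcal{L}(^m\mathbb{R}^n)$ is the space of $m$-linear forms $T:\mathbb{R}^n\times\cdots\times\mathbb{R}^n\to\mathbb{R}$ with norm $\|T\|=\sup_{\|x_1\|,\dots,\|x_m\|\le 1}|T(x_1,\dots,x_m)|$, and $B_{\mathcal{L}(^m\mathbb{R}^n)}$ is its closed unit ball. The coefficients of $T$ are the numbers $a_{\mathbf{i}}=T(e_{i_1},\dots,e_{i_m})$, $\mathbf{i}=(i_1,\dots,i_m)\in[n]^m$, where $e_1,\dots,e_n$ is the canonical basis of $\mathbb{R}^n$. *)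

(* Defs.v *)
From HB Require Import structures.
From mathcomp Require Import all_boot all_order all_algebra.
From mathcomp Require Import all_classical all_reals all_analysis.

Set Implicit Arguments.
Unset Strict Implicit.
Unset Printing Implicit Defensive.

Import Order.TTheory GRing.Theory Num.Theory.
Import numFieldNormedType.Exports.

Local Open Scope classical_set_scope.
Local Open Scope ring_scope.

Section MultilinearForms.
Variables (R : realType) (m n : nat).

(* A function of m vector variables takes a family x : 'I_m -> 'rV[R]_n;
   [@dfwith _ _ x k v] is x with its k-th vector replaced by v. *)
Definition multilinear_forms : set (('I_m -> 'rV[R]_n) -> R^o) :=
  [set T | forall (k : 'I_m) (x : 'I_m -> 'rV[R]_n),
     scalar (fun v : 'rV[R]_n => T (@dfwith _ _ x k v))].

(* The norm `|_| on 'rV[R]_n is the sup norm (mx_norm).  The real-valued [sup]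
   is 0 on unbounded sets, but a multilinear form on R^n is bounded on the
   product of unit balls, so on multilinear forms this is the usual norm. *)
Definition form_norm (T : ('I_m -> 'rV[R]_n) -> R^o) : R :=
  sup [set `|T x| | x in [set x : 'I_m -> 'rV[R]_n | forall k, `|x k| <= 1]].

Definition form_unit_ball : set (('I_m -> 'rV[R]_n) -> R^o) :=
  [set T | multilinear_forms T /\ form_norm T <= 1].

Definition form_coef (T : ('I_m -> 'rV[R]_n) -> R^o) (i : 'I_m -> 'I_n) : R :=
  T (fun k => delta_mx 0 (i k)).

End MultilinearForms.

Arguments multilinear_forms : clear implicits.
Arguments form_unit_ball : clear implicits.

Definition extreme_points (R : realType) (E : lmodType R) (A : set E) : set E :=
  [set a | A a /\ forall (b c : E) (t : R), A b -> A c -> 0 < t < 1 ->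
     a = t *: b + (1 - t) *: c -> b = a /\ c = a].

(* Main.v *)
(* A multilinear form on products of sup-norm balls attains its norm at a tuple
   of sign vectors, so the unit ball is cut out by finitely many inequalities
   |T s| <= 1, each linear in the coefficients of T with entries +-1.  If T is
   extreme, the constraints that are tight at T determine it: a form vanishing at
   all tight tuples could otherwise be added to and subtracted from T.  Hence the
   tight equations form a rational linear system that is injective over R, thus
   over Q, and a rational left inverse of it expresses the coefficients of T. *)

From HB Require Import structures.
Require Import Defs.
From mathcomp Require Import all_boot all_order all_algebra.
From mathcomp Require Import all_classical all_reals all_analysis.
From mathcomp Require Import lra.

Set Implicit Arguments.
Unset Strict Implicit.
Unset Printing Implicit Defensive.

Import Order.TTheory GRing.Theory Num.Theory.
Import numFieldNormedType.Exports.

Local Open Scope classical_set_scope.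
Local Open Scope ring_scope.

Section MultilinearForms.
Variables (R : realType) (m n : nat).
Implicit Types (T : ('I_m -> 'rV[R]_n) -> R^o) (x : 'I_m -> 'rV[R]_n).

Notation signs := {ffun 'I_m -> {ffun 'I_n -> bool}}.
Notation indices := {ffun 'I_m -> 'I_n}.

Definition sign_row (b : {ffun 'I_n -> bool}) : 'rV[R]_n := \row_j (-1) ^+ b j.

(* Coefficient families are encoded as row vectors through the enumeration of
   the finite type of multi-indices. *)
Definition form_of_coef (h : 'rV[R]_#|{: indices}|) : ('I_m -> 'rV[R]_n) -> R^o :=
  fun x => \sum_p h 0 p * \prod_k x k 0 ((enum_val p : indices) k).

Definition coef_row T : 'rV[R]_#|{: indices}| := \row_p form_coef T (enum_val p : indices).

Lemma form_coefE T (i : 'I_m -> 'I_n) :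
  form_coef T i = coef_row T 0 (enum_rank ([ffun k => i k] : indices)).
Proof.
rewrite mxE enum_rankK /form_coef; congr T.
by apply/funext => k; rewrite ffunE.
Qed.

Lemma dfwith_id x (k : 'I_m) : @dfwith _ _ x k (x k) = x.
Proof. by apply/funext => l; case: dfwithP. Qed.

Lemma multilinear_sum T x (k : 'I_m) (v : 'rV[R]_n) : multilinear_forms R m n T ->
  T (@dfwith _ _ x k v) = \sum_j v 0 j * T (@dfwith _ _ x k (delta_mx 0 j)).
Proof.
move=> /(_ k x) linT.
pose f : {scalar 'rV[R]_n} := HB.pack (fun v => T (@dfwith _ _ x k v) : R)
  (GRing.isLinear.Build _ _ _ _ (fun v => T (@dfwith _ _ x k v) : R) linT).
rewrite [v in LHS]row_sum_delta -[LHS]/(f _) linear_sum /=.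
by apply: eq_bigr => j _; rewrite -[LHS]/(f _) linearZ.
Qed.

(** Induction on [j], the number of leading arguments left arbitrary while the others are basis
    vectors; the last free argument is expanded in the basis. *)
Lemma multilinear_eq0 T : multilinear_forms R m n T ->
  (forall i : 'I_m -> 'I_n, form_coef T i = 0) -> forall x, T x = 0.
Proof.
move=> mT T0 x.
suff H j : (j <= m)%N -> forall y : 'I_m -> 'rV[R]_n,
    (forall k : 'I_m, (j <= k)%N -> exists i, y k = delta_mx 0 i) -> T y = 0.
  by apply: (H m) => // k; rewrite leqNgt ltn_ord.
elim: j => [_ y /(_ _ isT)|j IH jm y yE].
  by move=> /choice[i /funext ->]; exact: T0.
pose k := Ordinal jm.
rewrite -(dfwith_id y k) multilinear_sum// big1// => i _.
rewrite IH ?mulr0 ?(ltnW jm)// => l jl.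
have [<-|kl] := eqVneq k l; first by exists i; rewrite dfwithin.
rewrite dfwithout//; apply: yE; rewrite ltn_neqAle jl andbT.
by apply: contra kl => /eqP jl'; apply/eqP/val_inj.
Qed.

(** Giving each entry the sign of [c j] turns the sum into that of the [|c j|], which dominates
    because [|v 0 j| <= 1]. *)
Lemma norm_sum_le_sign (c : 'I_n -> R) (v : 'rV[R]_n) : `|v| <= 1 ->
  exists b, `|\sum_j v 0 j * c j| <= `|\sum_j sign_row b 0 j * c j|.
Proof.
move=> v1; exists [ffun j => c j < 0].
under [X in _ <= `|X|]eq_bigr do rewrite mxE ffunE -normrEsign.
rewrite [leRHS]ger0_norm ?sumr_ge0//.
apply: le_trans (ler_norm_sum _ _ _) _; apply: ler_sum => j _.
rewrite normrM ler_piMl//; apply: le_trans v1.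
by rewrite [leRHS]/Num.Def.normr /= mx_normrE; apply/bigmax_geP; right => /=; exists (0, j).
Qed.

(** Arguments are replaced by sign vectors one at a time: with the others fixed, [T] is linear in
    the current one. *)
Lemma norm_le_sign T x : multilinear_forms R m n T -> (forall k, `|x k| <= 1) ->
  exists s : signs, `|T x| <= `|T (sign_row \o s)|.
Proof.
move=> mT x1.
suff /(_ m (leqnn m))[s Hs] : forall j, (j <= m)%N -> exists s : signs,
    `|T x| <= `|T (fun k => if (k < j)%N then sign_row (s k) else x k)|.
  exists s; apply: (le_trans Hs); rewrite le_eqVlt; apply/orP; left; apply/eqP.
  by congr (`|T _|); apply/funext => k; rewrite ltn_ord.
elim=> [_|j IH jm].
  by exists [ffun=> [ffun=> false]].
have [s Hs] := IH (ltnW jm).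
pose k := Ordinal jm.
set y := (fun _ => _) in Hs.
have [b Hb] := norm_sum_le_sign (fun i => T (@dfwith _ _ y k (delta_mx 0 i))) (x1 k).
exists [ffun l => if l == k then b else s l].
apply: (le_trans Hs).
rewrite -[in leLHS](dfwith_id y k) (_ : y k = x k); last by rewrite /y ltnn.
rewrite multilinear_sum//; apply: (le_trans Hb); rewrite -multilinear_sum//.
rewrite le_eqVlt; apply/orP; left; apply/eqP; congr (`|T _|); apply/funext => l.
rewrite ffunE; case: dfwithP => [|l' kl]; first by rewrite eqxx ltnSn.
rewrite eq_sym (negbTE kl) /y ltnS [in RHS]leq_eqVlt.
by case: eqP => //= l'j; case/eqP: kl; apply/val_inj.
Qed.

Lemma norm_sign_row b : `|sign_row b| <= 1.
Proof.
rewrite [leLHS]/Num.Def.normr /= mx_normrE; apply/bigmax_leP; split => // -[i j] _ /=.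
by rewrite mxE normrX normrN1 expr1n.
Qed.

Lemma form_unit_ballP T : multilinear_forms R m n T ->
  form_unit_ball R m n T <-> forall s : signs, `|T (sign_row \o s)| <= 1.
Proof.
move=> mT; split=> [[_ T1] s|T1].
  apply: le_trans T1; apply: ub_le_sup.
    (* A crude upper bound, needed because [sup] is meaningful only on bounded sets. *)
    exists (\sum_(s : signs) `|T (sign_row \o s)|) => _ [x x1 <-].
    have [s' /le_trans] := norm_le_sign mT x1; apply.
    by rewrite (bigD1 s')//= lerDl sumr_ge0.
  by exists (sign_row \o s) => // k; exact: norm_sign_row.
split => //; apply: ge_sup.
  by exists `|T (fun=> 0)|; exists (fun=> 0) => // k; rewrite normr0.
by move=> _ [x x1 <-]; have [s /le_trans] := norm_le_sign mT x1; apply.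
Qed.

Lemma multilinear_lincomb (a b : R) T U : multilinear_forms R m n T ->
  multilinear_forms R m n U -> multilinear_forms R m n (a *: T + b *: U).
Proof.
move=> mT mU k x c u v; rewrite /= !fctE mT mU.
rewrite /GRing.scale /=; lra.
Qed.

Lemma multilinear_form_of_coef h : multilinear_forms R m n (form_of_coef h).
Proof.
move=> k x c u v; rewrite /form_of_coef /= mulr_sumr -big_split /=.
apply: eq_bigr => p _.
have E w : \prod_l @dfwith _ _ x k w l 0 ((enum_val p : indices) l) =
    w 0 ((enum_val p : indices) k) *
    \prod_(l | l != k) x l 0 ((enum_val p : indices) l).
  rewrite (bigD1 k)//= dfwithin; congr (_ * _).
  by apply: eq_bigr => l lk; rewrite dfwithout// eq_sym.
by rewrite !E !mxE; lra.
Qed.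

(** The monomial of index [q] at the basis tuple of index [p] is 1 if [q = p]; otherwise some factor
    vanishes. *)
Lemma coef_row_form_of_coef h : coef_row (form_of_coef h) = h.
Proof.
apply/rowP => p; rewrite mxE /form_coef /form_of_coef (bigD1 p)//= [X in _ + X]big1.
  rewrite addr0 big1 ?mulr1// => k _; by rewrite mxE !eqxx.
move=> q qp; apply/eqP; rewrite mulf_eq0; apply/orP; right.
have : enum_val q != enum_val p by apply: contra qp => /eqP/enum_val_inj ->.
move=> /eqP qp'; have [k kqp] : exists k, enum_val q k != enum_val p k.
  apply: contrapT => /forallNP H; apply: qp'; apply/ffunP => k.
  by apply/eqP; move: (H k) => /negP; rewrite negbK.
by rewrite (bigD1 k)//= mxE (negbTE kqp) andbF mul0r.
Qed.

Lemma coef_rowK T : multilinear_forms R m n T -> form_of_coef (coef_row T) = T.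
Proof.
move=> mT; set h := coef_row T.
apply/funext => x; apply/eqP; rewrite -subr_eq0; apply/eqP.
have mD := multilinear_lincomb 1 (-1) (multilinear_form_of_coef h) mT.
rewrite -[RHS](multilinear_eq0 mD _ x) ?fctE ?scale1r ?scaleN1r// => i.
rewrite form_coefE; set p := enum_rank _.
have /rowP/(_ p) := coef_row_form_of_coef h.
by rewrite !mxE /form_coef scale1r scaleN1r => ->; rewrite subrr.
Qed.

Lemma extreme_tight_inj T U : extreme_points (form_unit_ball R m n) T ->
  multilinear_forms R m n U ->
  (forall s : signs, `|T (sign_row \o s)| = 1 -> U (sign_row \o s) = 0) ->
  U = 0.
Proof.
move=> [T1 Text] mU U0; have mT := T1.1.
have {}T1 := (form_unit_ballP mT).1 T1.
(* Admissible step at [s]: the slack over the size of [U], with 1 added to keep the denominator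
   positive. Where [T] is tight [U] vanishes, so any positive value would do. *)
pose d (s : signs) : R := if `|T (sign_row \o s)| == 1 then 1 else
  (1 - `|T (sign_row \o s)|) / (1 + `|U (sign_row \o s)|).
pose t : R := \big[Num.min/1]_s d s.
have t0 : 0 < t.
  apply: lt_bigmin => [|s _]; first exact: ltr01.
   rewrite /d; case: ifPn => // Ts.
  by apply: divr_gt0; [rewrite subr_gt0 lt_neqAle Ts T1|rewrite ltr_pwDl].
have tU (s : signs) : `|T (sign_row \o s)| + t * `|U (sign_row \o s)| <= 1.
  have [Ts|Ts] := eqVneq `|T (sign_row \o s)| 1.
    by rewrite U0// normr0 mulr0 addr0 Ts.
  have : t <= d s by exact: bigmin_le_cond.
  rewrite /d (negbTE Ts) ler_pdivlMr ?ltr_pwDl//.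
  lra.
have ball (e : R) : `|e| = t -> form_unit_ball R m n (1 *: T + e *: U).
  move=> et; apply/form_unit_ballP; first exact: multilinear_lincomb.
  move=> s; apply: le_trans (tU s); rewrite !fctE scale1r.
  by apply: le_trans (ler_normD _ _) _; rewrite normrM et.
have half : 0 < (2^-1 : R) < 1 by apply/andP; split; lra.
(* [T] is the midpoint of [T + t U] and [T - t U], so extremality gives [t U = 0]. *)
have [] := Text _ _ _ (ball t (gtr0_norm t0)) (ball (- t) _) half.
- by rewrite normrN gtr0_norm.
- by apply/funext => x; rewrite !fctE /GRing.scale /=; lra.
move=> /eqP; rewrite scale1r addrC -subr_eq0 addrK scaler_eq0.
by rewrite gt_eqF//= => /eqP ->.
Qed.

End MultilinearForms.

Theorem corollary16 (R : realType) (m n : nat) (hm : (0 < m)%N) (hn : (0 < n)%N)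
    (T : ('I_m -> 'rV[R]_n) -> R^o)
    (hT : extreme_points (form_unit_ball R m n) T) (i : 'I_m -> 'I_n) :
  rational (form_coef T i).
Proof.
have mT := hT.1.1.
pose signs := {ffun 'I_m -> {ffun 'I_n -> bool}}.
pose indices := {ffun 'I_m -> 'I_n}.
pose pt (q : 'I_#|{: signs}|) := @sign_row R n \o enum_val q.
pose tight q := `|T (pt q)| == 1.
(* Constraints that are not tight contribute zero columns, so that M and b keep
   a fixed shape. *)
pose M : 'M[rat]_(#|{: indices}|, #|{: signs}|) := \matrix_(p, q)
  if tight q then \prod_k (-1) ^+ (enum_val q : signs) k ((enum_val p : indices) k) else 0.
pose b : 'rV[rat]_#|{: signs}| := \row_q if tight q then (-1) ^+ (T (pt q) < 0)%R else 0.
(* Multiplication by [M] evaluates a form, given by its coefficients, at the tight sign tuples. *)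
have ME (h : 'rV[R]_#|{: indices}|) q : (h *m map_mx ratr M) 0 q =
    if tight q then form_of_coef h (pt q) else 0.
  rewrite mxE /form_of_coef; case: ifPn => tq; last first.
    by rewrite big1// => p _; rewrite !mxE (negbTE tq) rmorph0 mulr0.
  apply: eq_bigr => p _; rewrite !mxE tq rmorph_prod; congr (_ * _).
  by apply: eq_bigr => k _; rewrite mxE rmorphXn rmorphN1.
(* Row freeness is unchanged by the extension from the rationals to [R], so it may be checked on
   real coefficient rows. *)
have Mfree : row_free M.
  rewrite -(row_free_map (@ratr R)); apply: inj_row_free => h hM0.
  suff h0 : form_of_coef h = 0.
    rewrite -(coef_row_form_of_coef h) h0.
    by apply/rowP => p; rewrite !mxE.
  apply: (extreme_tight_inj hT); first exact: multilinear_form_of_coef.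
  move=> s Ts; have := ME h (enum_rank s).
  by rewrite hM0 mxE /tight /pt enum_rankK Ts eqxx.
(* At a tight tuple [T] equals its own sign, so the right-hand side is rational. *)
have TM : coef_row T *m map_mx ratr M = map_mx ratr b.
  apply/rowP => q; rewrite ME coef_rowK// !mxE.
  case: ifPn => [/eqP Tq|_]; last by rewrite rmorph0.
  by rewrite rmorphXn rmorphN1 [LHS]numEsign Tq mulr1.
(* As [M] is row free, [pinvmx M] is a rational right inverse, which solves the system for the
   coefficients. *)
exists ((b *m pinvmx M) 0 (enum_rank [ffun k => i k])) => //.
rewrite form_coefE (_ : coef_row T = map_mx ratr (b *m pinvmx M)) ?mxE//.
by rewrite map_mxM -TM -mulmxA -map_mxM mulmxVp// map_mx1 mulmx1.
Qed.
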